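(* Let $X$ be a $\sigma$-set. Then for all $A,B\in 2^{X}$ we have $$A\oplus B=A\cup B,$$ where $A\cup B=\{x : x\in A\ \vee\ x\in B\}$.
   Context: Background on $\sigma$-sets: in $\sigma$-set theory (a theory of classes) two elements $x,y$ are called antielements of each other when $\{x\}\cup\{y\}=\emptyset$, where $\cup$ here is the primitive pair union of the theory. If $x$ has an antielement it is denoted $x^{\ast}$; the relation is symmetric, so $(x^{\ast})^{\ast}=x$. Not every element has an antielement; if $x$ has none, then the condition ''$x^{\ast}\in B$'' is false. A basic known fact of the theory (''exclusion of inverses'') is that a $\sigma$-set never contains both an element $x$ and its antielement $x^{\ast}$ (collections containing both are proper classes, not $\sigma$-sets). $\sigma$-sets are determined by their elements, and $\emptyset$ is the $\sigma$-set with no elements. Definitions, for $\sigma$-sets $A,B$: - $2^{X}$ is the collection of all subsets of $X$. - $\ast$-intersection: $A\widehat{\cap}B=\{x\in A : x^{\ast}\in B\}$. - Difference: $A-B=\{x\in A: x\notin B\}$. - $\ast$-difference: $A\divideontimes B=A-(A\widehat{\cap}B)$. - Fusion: $A\oplus B=\{x : x\in A\divideontimes B\ \vee\ x\in B\divideontimes A\}$. *)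

(* Defs.v *)
From mathcomp Require Import all_boot.
From mathcomp Require Import boolp classical_sets.

Set Implicit Arguments.
Unset Strict Implicit.
Unset Printing Implicit Defensive.

Local Open Scope classical_set_scope.

(* The universe of sigma-sets, in the style of a two-sorted theory of classes:
   the carrier is the sort of sigma-sets (the possible elements), and a
   sigma-class is a [set] over the carrier. [ss_elems] sends a sigma-set to the
   class of its elements; a class outside its range is proper. The
   axioms of sigma-set theory other than those below are not assumed. *)
Record sigmaTheory := SigmaTheory {
  ss_sort :> Type;
  ss_elems : ss_sort -> set ss_sort;
  ss_empty : ss_sort;
  (* [ss_pairU x y] is the primitive {x} U {y}; it is not the union of
     classes, since it is empty when x and y are antielements. *)
  ss_pairU : ss_sort -> ss_sort -> ss_sort;
  ss_ext : forall A B, ss_elems A = ss_elems B -> A = B;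
  ss_empty_elems : ss_elems ss_empty = set0;
  ss_anti_sym : forall x y,
    ss_pairU x y = ss_empty -> ss_pairU y x = ss_empty;
  ss_anti_unique : forall x y z,
    ss_pairU x y = ss_empty -> ss_pairU x z = ss_empty -> y = z;
  ss_exclusion : forall A x y,
    ss_elems A x -> ss_elems A y -> ss_pairU x y <> ss_empty
}.

Definition antielement (T : sigmaTheory) (x y : T) : Prop :=
  ss_pairU x y = ss_empty T.

(* "x^* belongs to B": false when x has no antielement. *)
Definition star_in (T : sigmaTheory) (x : T) (B : set T) : Prop :=
  exists2 y : T, antielement x y & B y.

Definition subsets (T : sigmaTheory) (X : T) : set T :=
  [set A : T | ss_elems A `<=` ss_elems X].

Definition star_inter (T : sigmaTheory) (A B : set T) : set T :=
  [set x | A x /\ star_in x B].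

Definition star_diff (T : sigmaTheory) (A B : set T) : set T :=
  A `\` star_inter A B.

Definition fusion (T : sigmaTheory) (A B : set T) : set T :=
  [set x | star_diff A B x \/ star_diff B A x].

(* Main.v *)
Require Import Defs.
From mathcomp Require Import all_boot.
From mathcomp Require Import boolp classical_sets.

Local Open Scope classical_set_scope.

(** Both sets lie inside the one sigma-set [X], and exclusion of inverses forbids [X] to hold an
    element together with its antielement. Hence nothing in [A] cancels against [B] or conversely
    ([star_inter_subsets]), and the fusion loses no element. *)

Lemma star_inter_subsets (T : sigmaTheory) (X A B : T) :
  subsets X A -> subsets X B -> star_inter (ss_elems A) (ss_elems B) = set0.
Proof.
move=> AX BX; apply/seteqP; split=> // x [/AX Xx [y xy /BX Xy]].
exact: ss_exclusion Xx Xy xy.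
Qed.

Lemma star_diff_subsets (T : sigmaTheory) (X A B : T) :
  subsets X A -> subsets X B ->
  star_diff (ss_elems A) (ss_elems B) = ss_elems A.
Proof.
by move=> AX BX; rewrite /star_diff (star_inter_subsets _ _ _ _ AX BX) setD0.
Qed.

Theorem theorem1p17 (T : sigmaTheory) (X : T) :
  forall A B : T, subsets X A -> subsets X B ->
    fusion (ss_elems A) (ss_elems B) = ss_elems A `|` ss_elems B.
Proof.
move=> A B AX BX.
(* Once both differences collapse to the sets themselves, what is left is the union by
   definition. *)
by rewrite /fusion (star_diff_subsets _ _ _ _ AX BX)
  (star_diff_subsets _ _ _ _ BX AX).
Qed.
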